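(* Let $H=\langle x_1,\ldots,x_n\mid R\rangle$ be a reduced presentation for a non-cyclic finitely generated left orderable group, and let $K=\langle y,x_1,\ldots,x_n\mid R,\ x_1=y^2\rangle$. Then $K$ contains a nonabelian free group.
   Context: A group is left orderable if it admits a left-invariant total order. A presentation $H=\langle x_1,\ldots,x_n\mid R\rangle$ is called reduced if $x_i$ is nontrivial in $H$ for each $i$. *)

(* Defs.v *)
(* MathComp, with excluded middle from boolp to decide the word problem.
   groupType is the structure of possibly infinite groups. *)
From HB Require Import structures.
From mathcomp Require Import all_boot boolp.

Set Implicit Arguments.
Unset Strict Implicit.
Unset Printing Implicit Defensive.

Local Open Scope group_scope.
Local Open Scope quotient_scope.

(* A word in the letters x and x^-1; (x, true) stands for x and (x, false)
   for x^-1. *)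
Definition word (X : Type) := seq (X * bool).

Definition letter (X : Type) (x : X) : word X := [:: (x, true)].

Definition inv_word (X : Type) (w : word X) : word X :=
  rev [seq (l.1, ~~ l.2) | l <- w].

Definition map_word (X Y : Type) (f : X -> Y) (w : word X) : word Y :=
  [seq (f l.1, l.2) | l <- w].

(* R u v means that u = v is one of the defining relations; a relator r is the
   relation r = 1, i.e. R r [::]. There may be infinitely many relations. *)
Definition relations (X : Type) := word X -> word X -> Prop.

Inductive word_eq (X : Type) (R : relations X) : word X -> word X -> Prop :=
| word_eq_rel u v : R u v -> word_eq R u v
| word_eq_cancel x b : word_eq R [:: (x, b); (x, ~~ b)] [::]
| word_eq_cat u u' v v' :
    word_eq R u u' -> word_eq R v v' -> word_eq R (u ++ v) (u' ++ v')
| word_eq_refl u : word_eq R u u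
| word_eq_sym u v : word_eq R u v -> word_eq R v u
| word_eq_trans v u w : word_eq R u v -> word_eq R v w -> word_eq R u w.

Section PresentedGroup.
Variables (X : choiceType) (R : relations X).
Implicit Types u v w : word X.

Definition word_eqb : rel (word X) := fun u v => `[< word_eq R u v >].

Lemma word_eqb_refl : reflexive word_eqb.
Proof. by move=> u; apply/asboolP; exact: word_eq_refl. Qed.

Lemma word_eqb_sym : symmetric word_eqb.
Proof. by move=> u v; apply/asboolP/asboolP; exact: word_eq_sym. Qed.

Lemma word_eqb_trans : transitive word_eqb.
Proof.
move=> v u w /asboolP uv /asboolP vw; apply/asboolP; exact: word_eq_trans vw.
Qed.

Canonical word_eqb_equiv :=
  EquivRel word_eqb word_eqb_refl word_eqb_sym word_eqb_trans.

(* The group < X | R >. *)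
Definition presented := {eq_quot word_eqb}.

HB.instance Definition _ := Choice.on presented.

Definition class_of (w : word X) : presented := \pi_{eq_quot word_eqb} w.

Lemma class_of_eq u v : class_of u = class_of v <-> word_eq R u v.
Proof.
by split=> [/eqmodP/asboolP // | uv]; apply/eqmodP/asboolP.
Qed.

Lemma class_of_repr (a : presented) : class_of (repr a) = a.
Proof. exact: reprK. Qed.

Lemma word_eq_invl w : word_eq R (inv_word w ++ w) [::].
Proof.
elim: w => [|[x b] w IH]; first exact: word_eq_refl.
rewrite /inv_word /= rev_cons -cats1 -catA.
apply: word_eq_trans IH; apply: word_eq_cat; first exact: word_eq_refl.
have xb := word_eq_cancel R x (~~ b); rewrite negbK in xb.
exact: (word_eq_cat xb (word_eq_refl _ w)).
Qed.

Lemma inv_wordK : involutive (@inv_word X).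
Proof.
move=> w; rewrite /inv_word map_rev revK -map_comp -[RHS]map_id.
by apply: eq_map => -[x b] /=; rewrite negbK.
Qed.

Lemma word_eq_invr w : word_eq R (w ++ inv_word w) [::].
Proof. by have := word_eq_invl (inv_word w); rewrite inv_wordK. Qed.

Lemma word_eq_inv u v : word_eq R u v -> word_eq R (inv_word u) (inv_word v).
Proof.
move=> uv; apply: (@word_eq_trans _ _ (inv_word u ++ (v ++ inv_word v))).
  rewrite -[X in word_eq _ X _]cats0.
  apply: word_eq_cat; first exact: word_eq_refl.
  exact/word_eq_sym/word_eq_invr.
rewrite catA -[X in word_eq _ _ X]cat0s.
apply: word_eq_cat (word_eq_refl _ _).
apply: word_eq_trans (word_eq_invl u).
exact: word_eq_cat (word_eq_refl _ _) (word_eq_sym uv).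
Qed.

Definition presented_mul (a b : presented) := class_of (repr a ++ repr b).
Definition presented_inv (a : presented) := class_of (inv_word (repr a)).

Lemma repr_class u : word_eq R (repr (class_of u)) u.
Proof. by apply/class_of_eq; rewrite class_of_repr. Qed.

Lemma class_of_cat u v :
  class_of (u ++ v) = presented_mul (class_of u) (class_of v).
Proof.
by apply/class_of_eq; apply: word_eq_cat; exact/word_eq_sym/repr_class.
Qed.

Lemma presented_mulA : associative presented_mul.
Proof.
move=> a b c; rewrite -[a]class_of_repr -[b]class_of_repr -[c]class_of_repr.
by rewrite -!class_of_cat catA.
Qed.

Lemma presented_mul1 : left_id (class_of [::]) presented_mul.
Proof. by move=> a; rewrite -[a]class_of_repr -class_of_cat. Qed.

Lemma presented_1mul : right_id (class_of [::]) presented_mul.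
Proof. by move=> a; rewrite -[a]class_of_repr -class_of_cat cats0. Qed.

Lemma class_of_inv u : class_of (inv_word u) = presented_inv (class_of u).
Proof.
by apply/class_of_eq; apply: word_eq_inv; exact/word_eq_sym/repr_class.
Qed.

Lemma presented_mulV :
  left_inverse (class_of [::]) presented_inv presented_mul.
Proof.
move=> a; rewrite -[a]class_of_repr -class_of_inv -class_of_cat.
by apply/class_of_eq; exact: word_eq_invl.
Qed.

Lemma presented_Vmul :
  right_inverse (class_of [::]) presented_inv presented_mul.
Proof.
move=> a; rewrite -[a]class_of_repr -class_of_inv -class_of_cat.
by apply/class_of_eq; exact: word_eq_invr.
Qed.

HB.instance Definition _ := isGroup.Build presented
  presented_mulA presented_mul1 presented_1mul presented_mulV presented_Vmul.

Definition gen (x : X) : presented := class_of (letter x).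

End PresentedGroup.

Definition free_group (X : choiceType) := presented (fun _ _ : word X => False).

Definition left_orderable (G : groupType) : Prop :=
  exists le : rel G,
    [/\ reflexive le, antisymmetric le, transitive le, total le
      & forall c a b : G, le a b -> le (c * a) (c * b)].

Definition cyclic_group (G : groupType) : Prop :=
  exists g : G, forall h : G, exists k : nat, h = g ^+ k \/ h = g ^- k.

Definition abelian_group (G : groupType) : Prop :=
  forall a b : G, a * b = b * a.

Definition contains_nonabelian_free (G : groupType) : Prop :=
  exists X : choiceType, ~ abelian_group (free_group X) /\
    exists f : {multiplicative free_group X -> G}, injective f.

Definition reduced_presentation (X : choiceType) (R : relations X) : Prop :=
  forall x : X, gen R x <> 1.

(* The relations of < y, X | R, x0 = y^2 >; the new generator y is None. *)
Inductive sqrt_relations (X : Type) (R : relations X) (x0 : X) :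
    relations (option X) :=
| sqrt_old u v : R u v ->
    sqrt_relations R x0 (map_word Some u) (map_word Some v)
| sqrt_new : sqrt_relations R x0 (letter (Some x0)) (letter None ++ letter None).

(* Main.v *)
(* K is the amalgam of H and <y> over x1 = y^2, so it acts on the Bass-Serre
   tree, whose vertices K / H are words in y and representatives of the cosets
   of C = <x1>. If C, aC, bC are distinct in H, then any odd power of y moves
   every branch other than C into C, so a y a^-1 (and its inverse) moves the
   complement of the branch aC into aC; playing ping-pong with the branches aC,
   bC and their y-translates, y a y a^-1 and y b y b^-1 generate a free group.
   Otherwise C has index at most 2 in H, and a torsion-free group with an
   infinite cyclic subgroup of index at most 2 is cyclic. *)
From HB Require Import structures.
Require Import Defs.
From mathcomp Require Import all_boot boolp.

Set Implicit Arguments.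
Unset Strict Implicit.
Unset Printing Implicit Defensive.

Local Open Scope group_scope.

(** * Morphisms out of free groups *)

Section Evaluation.
Variables (X : choiceType) (G : groupType) (g : X -> G).
Implicit Types (l : X * bool) (u v w : word X).

Definition eval_letter l : G := if l.2 then g l.1 else (g l.1)^-1.

Definition eval w : G := foldr (fun l a => eval_letter l * a) 1 w.

Lemma eval_cat u v : eval (u ++ v) = eval u * eval v.
Proof. by elim: u => [|l u IH] /=; rewrite ?mul1g // IH mulgA. Qed.

Lemma eval_word_eq (R : relations X) :
  (forall u v, R u v -> eval u = eval v) ->
  forall u v, word_eq R u v -> eval u = eval v.
Proof.
move=> gR u v; elim=> {u v} //.
- by move=> x [] /=; rewrite /eval_letter /= mulg1 ?mulgV ?mulVg.
- by move=> u u' v v' _ uu' _ vv'; rewrite !eval_cat uu' vv'.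
- by move=> v u w _ -> _ ->.
Qed.

Definition free_morphism (a : free_group X) : G := eval (repr a).

Lemma free_morphism_class w : free_morphism (class_of _ w) = eval w.
Proof. by apply: (eval_word_eq (R := fun _ _ => False)) (repr_class _ w). Qed.

Lemma free_morphismM : {morph free_morphism : a b / a * b}.
Proof.
by move=> a b; rewrite [a * b]/(presented_mul a b) free_morphism_class eval_cat.
Qed.

End Evaluation.

HB.instance Definition _ (X : choiceType) (G : groupType) (g : X -> G) :=
  isMultiplicative.Build _ _ (free_morphism g) (free_morphismM g).

(** * Freely reduced words *)

Section ReducedWords.
Variable X : choiceType.
Implicit Types (l : X * bool) (u v w : word X).

Definition inv_letter l := (l.1, ~~ l.2).

Definition reduced w := sorted (fun l l' => l' != inv_letter l) w.

Definition push l w :=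
  if w is l' :: w' then if l' == inv_letter l then w' else l :: w else [:: l].

Lemma reduced_push l w : reduced w -> reduced (push l w).
Proof.
case: w => [|l' w] //= red_w; case: ifPn => [_|ne /=]; last by rewrite ne.
exact: path_sorted red_w.
Qed.

Lemma push_word_eq (R : relations X) l w : word_eq R (l :: w) (push l w).
Proof.
case: w => [|l' w] /=; first exact: word_eq_refl.
case: eqP => [-> | _]; last exact: word_eq_refl.
case: l => x b.
exact: (word_eq_cat (word_eq_cancel R x b) (word_eq_refl R w)).
Qed.

Lemma reduced_exists (R : relations X) w :
  exists2 v, reduced v & word_eq R w v.
Proof.
elim: w => [|l w [v red_v wv]]; first by exists [::] => //; exact: word_eq_refl.
exists (push l v); first exact: reduced_push.
apply: word_eq_trans (push_word_eq R l v).
exact: (word_eq_cat (word_eq_refl R [:: l]) wv).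
Qed.

End ReducedWords.

(** * The ping-pong lemma *)

Section PingPong.
Variables (X : choiceType) (G : groupType) (g : X -> G).
(** [A l] is the attracting set of the letter [l]. The group acts on itself by left multiplication,
    with base point [1] outside every set. *)
Variable A : X * bool -> G -> Prop.
Hypothesis A_disjoint : forall l l' a, A l a -> A l' a -> l = l'.
Hypothesis A1 : forall l, ~ A l 1.
Hypothesis A_letter :
  forall l a, ~ A (inv_letter l) a -> A l (eval_letter g l * a).

(** The value of the tail lies in [A l']; as [l'] is not the inverse of [l], disjointness keeps it
    out of [A (inv_letter l)], so [l] attracts it. *)
Lemma ping_pong_word l (w : word X) : reduced (l :: w) -> A l (eval g (l :: w)).
Proof.
elim: w l => [|l' w IH] l /=; first by move=> _; exact: A_letter.
case/andP=> ne red_w; apply: A_letter => Al; move/eqP: ne; apply.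
exact: A_disjoint (IH _ red_w) Al.
Qed.

Lemma ping_pong_neq1 l (w : word X) : reduced (l :: w) -> eval g (l :: w) <> 1.
Proof.
by move=> red_w w1; apply: (A1 (l := l)); rewrite -w1; exact: ping_pong_word.
Qed.

Lemma ping_pong_injective : injective (free_morphism g).
Proof.
move=> a b ab; suff /divg1_eq : a / b = 1 by [].
have : free_morphism g (a / b) = 1.
  apply: (mulIg (free_morphism g b)).
  by rewrite -free_morphismM divgK mul1g.
rewrite -[a / b]class_of_repr free_morphism_class.
have [v red_v wv] := reduced_exists (fun _ _ => False) (repr (a / b)).
have /class_of_eq -> := wv; have -> // := eval_word_eq (g := g) _ wv.
by case: v red_v {wv} => [//|l v] /ping_pong_neq1.
Qed.

Lemma ping_pong_free (x x' : X) : x != x' -> contains_nonabelian_free G.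
Proof.
move=> ne; exists X; split; last first.
  by exists (free_morphism g); exact: ping_pong_injective.
move=> abX.
(* A commutator of distinct generators is a nonempty reduced word, but its value would be [1] if the
   free group were abelian. *)
pose w := [:: (x, true); (x', true); (x, false); (x', false)].
have red_w : reduced w.
  by rewrite /reduced /w /inv_letter /= !xpair_eqE /= !(eq_sym x') (negbTE ne).
apply: (ping_pong_neq1 red_w).
have com : g x * g x' = g x' * g x.
  have := congr1 (free_morphism g) (abX (gen _ x) (gen _ x')).
  rewrite !free_morphismM !free_morphism_class /= /eval_letter /=.
  by rewrite !mulg1.
by rewrite /= /eval_letter /= mulg1 mulgA com !mulgA mulgK mulgV.
Qed.

End PingPong.

Lemma eval_gen (X : choiceType) (R : relations X) (w : word X) :
  eval (gen R) w = class_of R w.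
Proof.
elim: w => [//|[x b] w IH]; rewrite /= IH -[_ :: w]cat1s class_of_cat.
congr (_ * _); case: b => //=; rewrite /eval_letter /= /gen.
by rewrite -[LHS]/(presented_inv _) -class_of_inv.
Qed.

(** * The cyclic subgroup generated by an element *)

Section Powers.
Variables (G : groupType) (x : G).

Definition powers : {pred G} :=
  fun h => `[< exists k : nat, h = x ^+ k \/ h = x ^- k >].

Lemma powersP h :
  reflect (exists k : nat, h = x ^+ k \/ h = x ^- k) (h \in powers).
Proof. exact: asboolP. Qed.

Lemma powers_id : x \in powers.
Proof. by apply/powersP; exists 1%N; left. Qed.

Lemma powers1 : 1 \in powers.
Proof. by apply/powersP; exists 0%N; left. Qed.

Lemma powersV : {in powers, forall h, h^-1 \in powers}.
Proof.
move=> h /powersP[k [->|->]]; apply/powersP; exists k; first by right.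
by left; rewrite invgK.
Qed.

Lemma powers_mul_id h : h \in powers -> x * h \in powers.
Proof.
move=> /powersP[k [->|->]]; apply/powersP.
  by exists k.+1; left; rewrite expgS.
by case: k => [|k]; [exists 1%N; left; rewrite invg1 mulg1
                    | exists k; right; rewrite expgSr invgM mulVKg].
Qed.

Lemma powers_mul_idV h : h \in powers -> x^-1 * h \in powers.
Proof.
by move=> /powersV /powersP[k [|]] /(canRL invgK) ->; apply/powersP;
  [exists k.+1; right; rewrite expgSr invgM
  | case: k => [|k]; [exists 1%N; right; rewrite !invg1 mulg1
                     | exists k; left; rewrite invgK expgS mulKg]].
Qed.

Lemma powersM : {in powers &, forall g h, g * h \in powers}.
Proof.
move=> g h /powersP[k [->|->]] hx; elim: k => [|k IH].
- by rewrite mul1g.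
- by rewrite expgS -mulgA powers_mul_id.
- by rewrite invg1 mul1g.
- by rewrite expgSr invgM -mulgA powers_mul_idV.
Qed.

HB.instance Definition _ := isMulClosed.Build G powers powersM.
HB.instance Definition _ := isMul1Closed.Build G powers powers1.
HB.instance Definition _ := isInvClosed.Build G powers powersV.

Lemma powers_commute h : h \in powers -> commute x h.
Proof. by case/powersP=> k [->|->]; [|apply: commuteV]; exact/commuteX. Qed.

End Powers.

(** * Representatives of left cosets *)

Section CosetRepresentative.
Variables (G : groupType) (S : groupClosed G).

(* The left coset S itself is represented by 1. *)
Definition coset_rep (h : G) : G :=
  if h \in S then 1 else choose (fun g => h^-1 * g \in S) h.

Lemma coset_rep_mem h : h^-1 * coset_rep h \in S.
Proof.
rewrite /coset_rep; case: ifP => hS; first by rewrite mulg1 gpredV.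
by apply: (@chooseP _ (fun g => h^-1 * g \in S)); rewrite mulVg gpred1.
Qed.

Lemma coset_rep_memV h : (coset_rep h)^-1 * h \in S.
Proof. by rewrite -gpredV invgM invgK coset_rep_mem. Qed.

Lemma coset_rep_eq g h : (coset_rep g == coset_rep h) = (g^-1 * h \in S).
Proof.
apply/eqP/idP => [gh|ghS].
  rewrite -[h](mulVKg (coset_rep h)) mulgA.
  by rewrite gpredM ?coset_rep_memV // -gh coset_rep_mem.
have hE : h = g * (g^-1 * h) by rewrite mulVKg.
rewrite /coset_rep hE gpredMr //; case: ifP => // _; rewrite -hE.
(* Both elements define the same coset predicate, and [choose] depends on that predicate only, not
   on the witness supplied. *)
have PE : (fun a => h^-1 * a \in S) =1 (fun a => g^-1 * a \in S).
  by move=> a; rewrite {1}hE invgM -mulgA gpredMl // gpredV.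
by rewrite (eq_choose PE); apply: choose_id; rewrite ?mulVg ?gpred1.
Qed.

Lemma coset_rep1 : coset_rep 1 = 1.
Proof. by rewrite /coset_rep gpred1. Qed.

Lemma coset_rep_eq1 h : (coset_rep h == 1) = (h \in S).
Proof. by rewrite -{1}coset_rep1 coset_rep_eq mulg1 gpredV. Qed.

Lemma coset_rep_id h : coset_rep (coset_rep h) = coset_rep h.
Proof. by apply/eqP; rewrite coset_rep_eq coset_rep_memV. Qed.

Lemma coset_repMr g h : coset_rep (g * coset_rep h) = coset_rep (g * h).
Proof. by apply/eqP; rewrite coset_rep_eq invgM -mulgA mulKg coset_rep_memV. Qed.

End CosetRepresentative.

(** * Normal forms of vertices; the actions of H and y *)

(* [:: s1; ...; sk] stands for the coset s1 y s2 y ... sk y H in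
   K = H *_(x = y^2) <y>, where the si represent the cosets of <x> in H. *)
Section TreeAction.
Variables (H : groupType) (x : H).
Implicit Types (g h s : H) (l : seq H).

Notation rep := (coset_rep (powers x)).

(** Normal form: a [1] after the first entry would create [y y = x], which shortens the word. *)
Definition vertex l :=
  all (fun s => rep s == s) l && all (fun s => s != 1) (behead l).

(** [h * s] is its representative times a power of [x]; that power commutes with [y], so it is
    carried to the next entry, and the last one is absorbed by H. *)
Fixpoint act h l :=
  if l is s :: l' then rep (h * s) :: act ((rep (h * s))^-1 * (h * s)) l'
  else [::].

(* The action of y; it squares to that of x only on reduced words. *)
Definition root_act l :=
  if l is s :: l' then if s == 1 then act x l' else 1 :: l else [:: 1].

Lemma actM g h l : act (g * h) l = act g (act h l).
Proof.
elim: l g h => [//|s l IH] g h /=; rewrite coset_repMr mulgA -IH.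
by rewrite !mulgA mulgK.
Qed.

Lemma act1 l : vertex l -> act 1 l = l.
Proof.
case/andP=> + _; elim: l => [//|s l IH] /= /andP[/eqP sE /IH lE].
by rewrite mul1g sE mulVg lE.
Qed.

Lemma actK h l : vertex l -> act h^-1 (act h l) = l.
Proof. by move=> vl; rewrite -actM mulVg act1. Qed.

Lemma actVK h l : vertex l -> act h (act h^-1 l) = l.
Proof. by move=> vl; rewrite -actM mulgV act1. Qed.

(** A carried power of [x] cannot turn the next entry into [1], because [c * s] lies in [<x>] only
    if [s] does; hence [act] preserves normal forms. *)
Lemma act_powers_neq1 c l : c \in powers x ->
  ohead l != Some 1 -> vertex l -> ohead (act c l) != Some 1.
Proof.
case: l => [//|s l] cx /= s1 /andP[/andP[/eqP sE _] _].
by rewrite /= -[_ == _]/(rep (c * s) == 1) coset_rep_eq1 gpredMl //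
           -(coset_rep_eq1 (powers x)) sE.
Qed.

Lemma vertex_cons s l :
  vertex (s :: l) = [&& rep s == s, vertex l & ohead l != Some 1].
Proof.
rewrite /vertex /=; case: l => [|t l] /=; first by rewrite andbT.
by rewrite -[Some t == _]/(t == 1); case: (t != 1); rewrite /= ?andbT ?andbF ?andbA.
Qed.

Lemma act_vertex h l : vertex l -> vertex (act h l).
Proof.
elim: l h => [//|s l IH] h; rewrite vertex_cons => /and3P[_ vl l1] /=.
rewrite vertex_cons coset_rep_id eqxx IH //=.
by apply: act_powers_neq1; rewrite ?coset_rep_memV.
Qed.

Lemma root_act_vertex l : vertex l -> vertex (root_act l).
Proof.
case: l => [|s l] vl /=; first by rewrite /vertex /= coset_rep1 eqxx.
case: eqP vl => [_|/eqP s1] vl.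
  by apply: act_vertex; move: vl; rewrite vertex_cons => /and3P[].
by rewrite vertex_cons coset_rep1 eqxx vl.
Qed.

(** If the head is [1], removing it leaves a head different from [1], so the second application puts
    a [1] back in front of [act x l']. *)
Lemma root_act_sqr l : vertex l -> root_act (root_act l) = act x l.
Proof.
have rep_x : rep x = 1 by apply/eqP; rewrite coset_rep_eq1 powers_id.
case: l => [|s l] vl /=; first by rewrite eqxx.
case: eqP vl => [->|_] vl; last by rewrite /= eqxx.
rewrite mulg1 rep_x invg1 mul1g.
move: vl; rewrite vertex_cons => /and3P[_ vl l1].
have := act_powers_neq1 (powers_id x) l1 vl.
by case: (act x l) => [//|t l'] /=; rewrite -[_ == _]/(t == 1) => /negbTE ->.
Qed.

Lemma root_act_powers c l : c \in powers x -> vertex l ->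
  root_act (act c l) = act c (root_act l).
Proof.
move=> cx; have rep_c : rep c = 1 by apply/eqP; rewrite coset_rep_eq1.
case: l => [|s l] vl /=; first by rewrite mulg1 rep_c.
move: (vl); rewrite vertex_cons => /and3P[/eqP sE _ _].
have -> : (rep (c * s) == 1) = (s == 1).
  by rewrite coset_rep_eq1 gpredMl // -(coset_rep_eq1 (powers x)) sE.
case: eqP => [->|_]; last by rewrite /= mulg1 rep_c invg1 mul1g.
by rewrite mulg1 rep_c invg1 mul1g -!actM (powers_commute cx).
Qed.

(** This encodes [y^-1 = x^-1 y]. *)
Definition root_actV l := act x^-1 (root_act l).

Lemma root_actK l : vertex l -> root_actV (root_act l) = l.
Proof. by move=> vl; rewrite /root_actV root_act_sqr // actK. Qed.

Lemma root_actVK l : vertex l -> root_act (root_actV l) = l.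
Proof.
move=> vl; rewrite /root_actV root_act_powers ?root_act_vertex //.
  by rewrite root_act_sqr // actK.
by rewrite gpredV powers_id.
Qed.

End TreeAction.

(** * The action of K on vertices *)

Section SquareRootAction.
Variables (X : choiceType) (R : relations X) (x0 : X).
Notation H := (presented R).
Notation K := (presented (sqrt_relations R x0)).
Implicit Types (u v : word (option X)) (l : seq H).

Let x : H := gen R x0.
Let y : K := gen _ None.

Definition letter_act (a : option X * bool) : seq H -> seq H :=
  match a with
  | (Some i, b) => act x (eval_letter (gen R) (i, b))
  | (None, true) => root_act x
  | (None, false) => root_actV x
  end.

Definition word_act u l := foldr letter_act l u.

Lemma word_act_vertex u l : vertex x l -> vertex x (word_act u l).
Proof.
move=> vl; elim: u => [//|[[i|] []] u IH] /=; try exact: act_vertex.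
- exact: root_act_vertex.
- exact/act_vertex/root_act_vertex.
Qed.

Lemma word_act_map (w : word X) l :
  vertex x l -> word_act (map_word Some w) l = act x (class_of R w) l.
Proof.
move=> vl; rewrite -eval_gen; elim: w => [|[i b] w IH] /=; first by rewrite act1.
by rewrite IH -actM.
Qed.

(** The action descends to K: old relations hold because old letters act through H, and the new one
    is [root_act_sqr]. *)
Lemma word_act_eq u v : word_eq (sqrt_relations R x0) u v ->
  forall l, vertex x l -> word_act u l = word_act v l.
Proof.
elim=> {u v} //.
- move=> _ _ [u v uv|] l vl.
    by rewrite !word_act_map //; have /word_eq_rel/class_of_eq -> := uv.
  by rewrite /= root_act_sqr.
- move=> [i|] [] l vl /=; rewrite /eval_letter /=.
  + exact: actVK.
  + exact: actK.
  + exact: root_actVK.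
  + exact: root_actK.
- move=> u u' v v' _ uu' _ vv' l vl.
  by rewrite /word_act !foldr_cat -!/(word_act _ _) vv' // uu' // word_act_vertex.
- by move=> u v _ uv l vl; rewrite uv.
- by move=> v u w _ uv _ vw l vl; rewrite uv // vw.
Qed.

(** The coset [k H], as the image of the base vertex. *)
Definition base_image (k : K) : seq H := word_act (repr k) [::].

Lemma base_image_vertex k : vertex x (base_image k).
Proof. exact: word_act_vertex. Qed.

Lemma base_image_class u k :
  base_image (class_of _ u * k) = word_act u (base_image k).
Proof.
rewrite -{1}[k]class_of_repr -[_ * _]class_of_cat /base_image.
by rewrite (word_act_eq (repr_class _ _)) // /word_act foldr_cat.
Qed.

Lemma base_image1 : base_image 1 = [::].
Proof. exact: (word_act_eq (repr_class _ [::])). Qed.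

Definition embed (h : H) : K := class_of _ (map_word Some (repr h)).

Lemma base_image_embed h k : base_image (embed h * k) = act x h (base_image k).
Proof.
by rewrite base_image_class word_act_map ?base_image_vertex // class_of_repr.
Qed.

Lemma base_image_embedV h k :
  base_image ((embed h)^-1 * k) = act x h^-1 (base_image k).
Proof.
by rewrite -{2}[k](mulVKg (embed h)) base_image_embed actK ?base_image_vertex.
Qed.

Lemma base_image_root k : base_image (y * k) = root_act x (base_image k).
Proof. exact: base_image_class. Qed.

Lemma base_image_rootV k : base_image (y^-1 * k) = root_actV x (base_image k).
Proof. by rewrite -{2}[k](mulVKg y) base_image_root root_actK ?base_image_vertex. Qed.

(** * Ping-pong between two branches and their y-translates *)

Section BranchPingPong.
Variable a : bool -> H.
Hypothesis a_notin : forall i, a i \notin powers x.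
Hypothesis a_distinct : (a true)^-1 * a false \notin powers x.

Notation rep := (coset_rep (powers x)).

Definition branch i (k : K) : bool := ohead (base_image k) == Some (rep (a i)).

Lemma branch_disjoint i j k : branch i k -> branch j k -> i = j.
Proof.
have ne : rep (a true) != rep (a false) by rewrite coset_rep_eq.
rewrite /branch => /eqP -> /eqP[]; case: i; case: j => // /eqP E.
  by rewrite E in ne.
by rewrite eq_sym E in ne.
Qed.

Lemma ohead_root_act l :
  ohead l != Some 1 -> ohead (root_act x l) = Some 1.
Proof. by case: l => [//|s l] /=; rewrite -[_ == _]/(s == 1) => /negbTE ->. Qed.

Lemma ohead_root_actV l :
  ohead l != Some 1 -> ohead (root_actV x l) = Some 1.
Proof.
move=> /ohead_root_act; rewrite /root_actV; case: (root_act x l) => //= s l' [->].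
by congr Some; apply/eqP; rewrite mulg1 coset_rep_eq1 gpredV powers_id.
Qed.

(** [y] sends the branch of [a i] into the branch of [<x>], which differs from that of [a j]. *)
Lemma branch_root_neq i j k : branch i (y^-1 * k) -> ~ branch j k.
Proof.
have neq1 h : rep (a h) != 1 by rewrite coset_rep_eq1.
rewrite /branch -{2}[k](mulVKg y) base_image_root => /eqP ei.
rewrite ohead_root_act; first by move=> /eqP[/esym/eqP]; apply/negP.
by rewrite ei; apply: contraNneq (neq1 i) => -[->].
Qed.

Lemma ohead_act_neq1 i l : vertex x l -> ohead l <> Some (rep (a i)) ->
  ohead (act x (a i)^-1 l) != Some 1.
Proof.
case: l => [//|s l] /=; rewrite vertex_cons => /andP[/eqP sE _] ns.
rewrite -[_ == _]/(rep _ == 1) coset_rep_eq1 -coset_rep_eq sE.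
by apply/eqP=> E; apply: ns; rewrite E.
Qed.

Lemma branch_act i l : ohead l = Some 1 -> ohead (act x (a i) l) = Some (rep (a i)).
Proof. by case: l => [//|s l] /= [->]; rewrite mulg1. Qed.

Definition ping (i : bool) : K := y * embed (a i) * y * (embed (a i))^-1.

(* The inverse of ping i (p.2 = false) is attracted to the branch of a i,
   and ping i itself to the y-translate of that branch. *)
Definition ping_set (p : bool * bool) (k : K) : Prop :=
  branch p.1 (if p.2 then y^-1 * k else k).

Lemma ping_set_disjoint p p' k : ping_set p k -> ping_set p' k -> p = p'.
Proof.
case: p => i []; case: p' => j [] /= bi bj.
- by congr (_, _); exact: branch_disjoint bi bj.
- by case: (branch_root_neq bi bj).
- by case: (branch_root_neq bj bi).
- by congr (_, _); exact: branch_disjoint bi bj.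
Qed.

Lemma ping_set1 p : ~ ping_set p 1.
Proof.
case: p => i []; rewrite /ping_set /branch /=.
  rewrite base_image_rootV base_image1 ohead_root_actV //.
  by rewrite -[_ == _]/(1 == rep _) eq_sym coset_rep_eq1 (negbTE (a_notin i)).
by rewrite base_image1.
Qed.

(** After cancelling [y] or grouping [y^-1] with [k], what acts is [a y a^-1] or [a y^-1 a^-1].
    Outside the branch of [a i], the factor [a^-1] lands off the branch of [<x>], the power of [y]
    moves into it, and [a] carries it to the branch of [a i]. *)
Lemma ping_set_letter p k :
  ~ ping_set (inv_letter p) k -> ping_set p (eval_letter ping p * k).
Proof.
case: p => i []; rewrite /ping_set /branch /eval_letter /ping /= => nk.
  rewrite !mulgA mulVg mul1g -!mulgA base_image_embed.
  rewrite base_image_root base_image_embedV; apply/eqP/branch_act/ohead_root_act.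
  by apply: ohead_act_neq1; [exact: base_image_vertex | exact/eqP/negP].
rewrite !invgM invgK -!mulgA base_image_embed base_image_rootV.
rewrite base_image_embedV; apply/eqP/branch_act/ohead_root_actV.
by apply: ohead_act_neq1; [exact: base_image_vertex | exact/eqP/negP].
Qed.

Lemma sqrt_contains_free : contains_nonabelian_free K.
Proof.
exact: (ping_pong_free ping_set_disjoint ping_set1 ping_set_letter
          (isT : true != false)).
Qed.

End BranchPingPong.
End SquareRootAction.

(** * Torsion-free groups and cyclic subgroups of index at most 2 *)

(** If [1 <= g], left invariance gives [g <= g ^+ n.+1 = 1], so [g = 1]; otherwise the same applies
    to [g^-1]. *)
Lemma left_orderable_torsion_free (G : groupType) : left_orderable G ->
  forall (g : G) n, g ^+ n.+1 = 1 -> g = 1.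
Proof.
case=> le [lexx le_anti le_trans le_total leM] g n gn.
have pow_ge m h : le 1 h -> le 1 (h ^+ m).
  move=> h1; elim: m => [//|m IH]; rewrite expgS.
  by apply: le_trans h1 _; rewrite -{1}[h]mulg1 leM.
have le1 h : h ^+ n.+1 = 1 -> le 1 h -> h = 1.
  move=> hn h1; apply: le_anti; rewrite h1 andbT -hn expgS -{1}[h]mulg1.
  by rewrite leM // pow_ge.
have /orP[g1|g1] := le_total 1 g; first exact: le1.
apply: invg_inj; rewrite invg1; apply: le1; first by rewrite expVgn gn invg1.
by rewrite -(mulVg g) -{2}[g^-1]mulg1 leM.
Qed.

Section IndexTwo.
Variables (G : groupType) (x a : G).
Hypothesis torsion_free : forall (g : G) n, g ^+ n.+1 = 1 -> g = 1.
Hypothesis x_neq1 : x <> 1.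
Hypothesis a_notin : a \notin powers x.
Hypothesis a_index2 : forall b, b \notin powers x -> a^-1 * b \in powers x.

Lemma expg_torsion_free m n : x ^+ m = x ^+ n -> m = n.
Proof.
wlog lt_mn : m n / m < n => [IH|].
  by case: (ltngtP m n) => // lt E; [|symmetry]; apply: IH.
move=> E; case: x_neq1; apply: (@torsion_free _ (n - m).-1).
by rewrite prednK ?subn_gt0 // expgnFr ?(ltnW lt_mn) // E mulgV.
Qed.

Lemma sqr_in_powers : a * a \in powers x.
Proof.
have /a_index2 : a^-1 \notin powers x by rewrite gpredV.
by rewrite -invgM gpredV.
Qed.

(** Conjugation by [a] sends [x] to a power of [x], and its square is conjugation by [a * a], which
    fixes [x]. So the exponent is 1 or -1, and -1 would give [a] torsion. *)
Lemma index2_commute : commute a x.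
Proof.
have conj_in : x ^ a \in powers x.
  (* [x ^ a] is [a^-1 * (x * a)], and [x * a] is outside [<x>] because [a] is. *)
  apply: a_index2; apply: contra a_notin => xa.
  by rewrite -(gpredMl (S := powers x) _ (powers_id x)).
have conj2 : (x ^ a) ^ a = x.
  rewrite -conjgM; apply/eqP; rewrite conjg_fix; apply/commgP.
  exact/powers_commute/sqr_in_powers.
case/powersP: conj_in => k [] xa.
  have k1 : (k * k = 1)%N.
    apply: expg_torsion_free; rewrite expg1 -[RHS]conj2 xa conjXg xa.
    by rewrite expgnA.
  have {}k1 : k = 1%N by case: k k1 {xa} => [|[|k]].
  by rewrite k1 expg1 in xa; rewrite /commute [RHS]conjgC xa.
have k1 : (k * k = 1)%N.
  apply: expg_torsion_free; rewrite expg1 -[RHS]conj2 xa conjVg conjXg xa.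
  by rewrite expVgn invgK expgnA.
have {}k1 : k = 1%N by case: k k1 {xa} => [|[|k]].
rewrite k1 expg1 in xa.
(* Conjugation by a fixes a * a but also inverts it, so a ^+ 4 = 1. *)
have inv_powers h : h \in powers x -> h ^ a = h^-1.
  by case/powersP=> m [] ->; rewrite ?conjVg conjXg xa expVgn.
have := inv_powers _ sqr_in_powers; rewrite conjgE mulgA mulKg => a2V.
case/negP: a_notin; rewrite (@torsion_free a 3) ?gpred1 //.
by rewrite !expgS expg0 mulg1 !mulgA -[_ * a * a]mulgA {1}a2V mulVg.
Qed.

(** Since [a] commutes with [x], multiplying it by a power of [x] reduces the exponent of its square
    modulo 2. An even exponent produces torsion; an odd one produces a square root of [x] that
    generates the group. *)
Lemma index2_cyclic : cyclic_group G.
Proof.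
have ax n : commute a (x ^+ n) := commuteX n index2_commute.
(* The powers of [g] contain [<x>] and an element of [a <x>], hence both cosets. *)
have odd_case g c :
    c \in powers x -> a * c \in powers g -> g * g = x -> cyclic_group G.
  move=> cx acg g2.
  have sub b : b \in powers x -> b \in powers g.
    have xg : x \in powers g by rewrite -g2 gpredM ?powers_id.
    by case/powersP=> k [] ->; rewrite ?gpredV gpredXn.
  have ag : a \in powers g by rewrite -(gpredMr (S := powers g) _ (sub _ cx)).
  exists g => h; apply/powersP.
  case: (boolP (h \in powers x)) => [/sub //|/a_index2 /sub].
  by rewrite gpredMl // gpredV.
have even_case c : c \in powers x -> a * c * (a * c) <> 1.
  move=> cx ac2; case/negP: a_notin.
  rewrite -(gpredMr (S := powers x) _ cx) (@torsion_free (a * c) 1) ?gpred1 //.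
have sqrM c : commute a c -> a * c * (a * c) = a * a * (c * c).
  by move=> ac; rewrite -mulgA (mulgA c) -ac !mulgA.
case/powersP: sqr_in_powers => n [] a2; set q := n./2.
  have qx : x ^- q \in powers x by rewrite gpredV gpredXn ?powers_id.
  have : a * x ^- q * (a * x ^- q) = x ^+ odd n.
    rewrite sqrM; last exact: commuteV (ax q).
    by rewrite a2 -invgM -expgnDr addnn -{1}(odd_double_half n) expgnDr mulgK.
  case: (odd n) => [g2|/even_case] //.
  by apply: (odd_case _ _ qx _ g2); exact: powers_id.
have qx : x ^+ q \in powers x by rewrite gpredXn ?powers_id.
have : a * x ^+ q * (a * x ^+ q) = x ^- odd n.
  rewrite sqrM // a2 -expgnDr addnn -{1}(odd_double_half n) addnC expgnDr.
  by rewrite invgM mulgVK.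
case: (odd n) => [g2|]; last by rewrite invg1 => /even_case.
(* Here [a * x ^+ q] squares to [x^-1], so its inverse is the square root of [x]. *)
apply: (odd_case (a * x ^+ q)^-1 _ qx).
  by rewrite -gpredV powers_id.
by rewrite -invgM g2 invgK.
Qed.

End IndexTwo.

Lemma noncyclic_three_cosets (G : groupType) (x : G) :
  left_orderable G -> ~ cyclic_group G -> x <> 1 ->
  exists a : bool -> G, (forall i, a i \notin powers x)
                        /\ (a true)^-1 * a false \notin powers x.
Proof.
move=> /left_orderable_torsion_free tf nc x1.
have [a ax] : exists a, a \notin powers x.
  apply: contra_notP nc => /forallNP all_x; exists x => h.
  by apply/powersP/negPn/negP/all_x.
have [b [bx abx]] : exists b, b \notin powers x /\ a^-1 * b \notin powers x.
  apply: contra_notP nc => /forallNP no_b; apply: (index2_cyclic tf x1 ax) => b bx.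
  by apply/negPn/negP => abx; apply: (no_b b).
by exists (fun i => if i then a else b); split => [[]|].
Qed.

Theorem theorem4p4 (n : nat) (R : relations 'I_n.+1) :
  reduced_presentation R ->
  ~ cyclic_group (presented R) ->
  left_orderable (presented R) ->
  contains_nonabelian_free (presented (sqrt_relations R ord0)).
Proof.
move=> red nc lo.
(* Reducedness gives [x1 <> 1], so by torsion-freeness [<x1>] is infinite. *)
have [a [a_notin a_distinct]] := noncyclic_three_cosets lo nc (red ord0).
exact: sqrt_contains_free a_notin a_distinct.
Qed.
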